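(* Fix $i\in[d]$ and let $v\in L^1(S)$. Let $U=\prod_{j\in[d]}(\alpha_j,\beta_j)$ be an open box containing $S$, and let $U_{-i}$ denote its projection onto the coordinates different from $i$. The following statements are equivalent. (i) There exists a finite-valued convex function $\widetilde v:U\to\mathbb R$ such that, after restriction to $S$, $$\bar\Pi_i(\widetilde v-v)=0\qquad\text{a.e. on }S_{-i}.$$ (ii) The slice-average profile $\bar\Pi_iv$ admits a representative on $S_{-i}$ that is the restriction of a finite-valued convex function $m_i:U_{-i}\to\mathbb R$. In particular, if $\bar\Pi_iv$ has no representative whose restriction to $\operatorname{ri}(S_{-i})$ is continuous, then no finite-valued convex function $\widetilde v$ on a neighborhood of $S$ can induce a residual $\widetilde v-v$ that is centered in direction $i$.
   Context: Let $d\ge 1$, $[d]=\{1,\dots,d\}$, and let $S=\prod_{j=1}^d[a_j,b_j]\subset\mathbb R^d$ be a box with $a_j<b_j$. Write $\omega_{-i}=(\omega_j)_{j\ne i}$ and $S_{-i}=\prod_{j\ne i}[a_j,b_j]$. For $\varphi\in L^1(S)$ the coordinate-$i$ slice-average profile is the function on $S_{-i}$ $$(\bar\Pi_i\varphi)(\omega_{-i})=\frac1{b_i-a_i}\int_{a_i}^{b_i}\varphi(\omega_{-i},t)\,dt\quad\text{for a.e. }\omega_{-i}\in S_{-i},$$ with $t$ inserted in the $i$th coordinate. $\varphi$ is centered in direction $i$ if $\bar\Pi_i\varphi=0$ a.e. on $S_{-i}$. A representative means a function equal a.e.; $\operatorname{ri}$ denotes relative interior. *)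

(* Defs.v *)
From HB Require Import structures.
From mathcomp Require Import all_boot all_order all_algebra.
From mathcomp Require Import all_classical all_reals all_analysis.

Set Implicit Arguments.
Unset Strict Implicit.
Unset Printing Implicit Defensive.

Import Order.TTheory GRing.Theory Num.Theory.
Import numFieldNormedType.Exports.

Local Open Scope classical_set_scope.
Local Open Scope ring_scope.

Section coordinates.
Context {R : realType}.

(* [omega_{-i}] is [col' i omega]; [insert_coord i x t] is the point with
   [omega_i = t] and [omega_{-i} = x]. *)
Definition insert_coord (d : nat) (i : 'I_d) (x : 'rV[R]_d.-1) (t : R)
    : 'rV[R]_d :=
  \row_j (if unlift i j is Some k then x 0 k else t).

Lemma insert_coord_eq (d : nat) (i : 'I_d) (x : 'rV[R]_d.-1) (t : R) :
  insert_coord i x t 0 i = t.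
Proof. by rewrite mxE unlift_none. Qed.

Lemma insert_coord_lift (d : nat) (i : 'I_d) (x : 'rV[R]_d.-1) (t : R) k :
  insert_coord i x t 0 (lift i k) = x 0 k.
Proof. by rewrite mxE liftK. Qed.

Definition box (d : nat) (a b : 'rV[R]_d) : set 'rV[R]_d :=
  [set x | forall j, a 0 j <= x 0 j <= b 0 j].

Definition open_box (d : nat) (a b : 'rV[R]_d) : set 'rV[R]_d :=
  [set x | forall j, a 0 j < x 0 j < b 0 j].

End coordinates.

(* The sigma-algebra on row vectors generated by the coordinate maps, i.e.
   the Borel sets of R^n. *)
Section measurable_rV.
Context {R : realType} (n : nat).

Definition rV_coord (i : 'I_n) (x : 'rV[R]_n) : measurableTypeR R := x 0 i.

Let rV_set0 : g_sigma_preimage rV_coord set0.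
Proof. exact: sigma_algebra0. Qed.

Let rV_setC A : g_sigma_preimage rV_coord A -> g_sigma_preimage rV_coord (~` A).
Proof. exact: sigma_algebraC. Qed.

Let rV_bigcup (F : (set 'rV[R]_n)^nat) :
  (forall i, g_sigma_preimage rV_coord (F i)) ->
  g_sigma_preimage rV_coord (\bigcup_i (F i)).
Proof. exact: sigma_algebra_bigcup. Qed.

HB.instance Definition _ := @isMeasurable.Build default_measure_display
  'rV[R]_n (g_sigma_preimage rV_coord) rV_set0 rV_setC rV_bigcup.

Lemma measurable_rV_coord (i : 'I_n) : measurable_fun setT (rV_coord i).
Proof.
move=> _ Y mY; rewrite setTI; apply: sub_sigma_algebra => /=.
rewrite -bigcup_seq/=; exists i => /=; first by rewrite mem_index_enum.
by exists Y => //; rewrite setTI.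
Qed.

Lemma measurable_fun_rV d' (T : measurableType d') (f : T -> 'rV[R]_n) :
  (forall i, measurable_fun setT (rV_coord i \o f)) -> measurable_fun setT f.
Proof.
move=> mf.
have H : g_sigma_preimage (fun i => rV_coord i \o f) `<=` measurable.
  apply: smallest_sub; first exact: sigma_algebra_measurable.
  rewrite -bigcup_seq; apply: bigcup_sub => i _ A [B mB <-]; exact: mf.
move=> _ A mA; apply: H; rewrite g_sigma_preimage_comp.
by exists A.
Qed.

Lemma measurable_box (a b : 'rV[R]_n) : measurable (box a b).
Proof.
have -> : box a b = \bigcap_(j in [set: 'I_n])
    (rV_coord j @^-1` [set` `[a 0 j, b 0 j]]).
  apply/seteqP; split=> x /= H j; first by move=> _ /=; rewrite in_itv/=.
  by have := H j I; rewrite /= in_itv/=.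
apply: fin_bigcap_measurable; first exact: finite_finset.
move=> j _; rewrite -[X in measurable X]setTI.
by apply: measurable_rV_coord => //; exact: measurable_itv.
Qed.

End measurable_rV.

Section lebesgue_rV.
Context {R : realType}.

Definition rV_cons (n : nat) (p : measurableTypeR R * 'rV[R]_n)
  : 'rV[R]_n.+1 := @insert_coord R n.+1 ord0 p.2 p.1.

Lemma measurable_rV_cons n : measurable_fun setT (@rV_cons n).
Proof.
apply: measurable_fun_rV => i.
case: (unliftP ord0 i) => [j ->|->].
- rewrite (_ : _ \o _ = rV_coord j \o snd).
    exact: measurableT_comp (measurable_rV_coord j) measurable_snd.
  by apply/funext => p /=; rewrite /rV_coord insert_coord_lift.
- rewrite (_ : _ \o _ = fst); first exact: measurable_fst.
  by apply/funext => p /=; rewrite /rV_coord insert_coord_eq.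
Qed.

Section succ.
Context (n : nat) (mu : {sigma_finite_measure set 'rV[R]_n -> \bar R}).
Local Open Scope ereal_scope.

Definition lebesgue_rV_succ : set 'rV[R]_n.+1 -> \bar R :=
  pushforward (@lebesgue_measure R \x mu) (@rV_cons n).


Let lebesgue_rV_succ0 : lebesgue_rV_succ set0 = 0.
Proof. by rewrite /lebesgue_rV_succ /pushforward preimage_set0 measure0. Qed.

Let lebesgue_rV_succ_ge0 A : 0 <= lebesgue_rV_succ A.
Proof. exact: (measure_ge0 (@lebesgue_measure R \x mu)). Qed.

Let lebesgue_rV_succ_sigma_additive : semi_sigma_additive lebesgue_rV_succ.
Proof.
move=> F mF tF mUF; rewrite /lebesgue_rV_succ /pushforward preimage_bigcup.
apply: (@measure_semi_sigma_additive _ _ _ (@lebesgue_measure R \x mu)%E).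
- by move=> k; rewrite -[X in measurable X]setTI; exact: measurable_rV_cons.
- apply/trivIsetP => /= k l _ _ kl; rewrite -preimage_setI.
  by move/trivIsetP : tF => /(_ _ _ _ _ kl) ->//; rewrite preimage_set0.
- by rewrite -preimage_bigcup -[X in measurable X]setTI;
    exact: measurable_rV_cons.
Qed.

HB.instance Definition _ := isMeasure.Build _ _ _ lebesgue_rV_succ
  lebesgue_rV_succ0 lebesgue_rV_succ_ge0 lebesgue_rV_succ_sigma_additive.

Let rV_uncons (x : 'rV[R]_n.+1) : measurableTypeR R * 'rV[R]_n :=
  (rV_coord ord0 x, @col' R 1 n.+1 ord0 x).

Let measurable_rV_uncons : measurable_fun setT rV_uncons.
Proof.
apply/measurable_fun_pairP; split; first exact: measurable_rV_coord.
apply: measurable_fun_rV => i.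
rewrite (_ : _ \o _ = rV_coord (lift ord0 i)); first exact: measurable_rV_coord.
by apply/funext => x /=; rewrite /rV_coord mxE.
Qed.

Let rV_consK : cancel (@rV_cons n) rV_uncons.
Proof.
move=> [t x]; rewrite /rV_uncons /rV_coord insert_coord_eq; congr pair.
by apply/rowP => j; rewrite mxE insert_coord_lift.
Qed.

Let lebesgue_rV_succ_sigma_finite : sigma_finite setT lebesgue_rV_succ.
Proof.
have [F FT mF] : sigma_finite setT (@lebesgue_measure R \x mu).
  have /sigma_finiteP[F [TF ndF Foo]] := sigma_finiteT (@lebesgue_measure R).
  have /sigma_finiteP[G [TG ndG Goo]] := sigma_finiteT mu.
  exists (fun k => F k `*` G k).
    rewrite -setXTT TF TG predeqE => -[x y]; split.
      move=> [/= [k _ Fkx] [l _ Gly]]; exists (maxn k l) => //; split.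
      - by move: x Fkx; exact/subsetPset/ndF/leq_maxl.
      - by move: y Gly; exact/subsetPset/ndG/leq_maxr.
    by move=> [k _ []/= ? ?]; split; exists k.
  move=> k; have [? ?] := Foo k; have [? ?] := Goo k.
  split; first exact: measurableX.
  by rewrite product_measure1E// lte_mul_pinfty// ge0_fin_numE.
exists (fun k => rV_uncons @^-1` F k).
  by rewrite -preimage_bigcup -FT preimage_setT.
move=> k; have [mFk Fk] := mF k; split.
  by rewrite -[X in measurable X]setTI; exact: measurable_rV_uncons.
rewrite /lebesgue_rV_succ /pushforward -comp_preimage.
by rewrite (_ : rV_uncons \o _ = id)//; apply/funext => z /=; rewrite rV_consK.
Qed.

HB.instance Definition _ := Measure_isSigmaFinite.Build _ _ _ lebesgue_rV_succ
  lebesgue_rV_succ_sigma_finite.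

End succ.

(* Lebesgue measure on R^n as an iterated product measure; on the one-point
   space R^0 it is the unit point mass. *)
Fixpoint lebesgue_rV (n : nat) : {sigma_finite_measure set 'rV[R]_n -> \bar R} :=
  match n with
  | 0 => @dirac _ 'rV[R]_0 0 R
  | m.+1 => lebesgue_rV_succ (lebesgue_rV m)
  end.

Lemma lebesgue_rV_box (n : nat) (a b : 'rV[R]_n) :
  (forall j, a 0 j <= b 0 j)%R ->
  lebesgue_rV n (box a b) = (\prod_j (b 0 j - a 0 j))%:E.
Proof.
elim: n a b => [|n IH] a b ab.
  rewrite big_ord0 /= diracE mem_set//= => j; by case: j.
rewrite big_ord_recl EFinM.
have -> : lebesgue_rV n.+1 (box a b) = (@lebesgue_measure R \x lebesgue_rV n)%E
    ([set` `[a 0 ord0, b 0 ord0]] `*`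
     box (@col' R 1 n.+1 ord0 a) (@col' R 1 n.+1 ord0 b)).
  congr (product_measure1 _ _ _); apply/seteqP; split => -[t x] /=.
    move=> H; split; first by have := H ord0; rewrite insert_coord_eq in_itv.
    by move=> j; have := H (lift ord0 j); rewrite insert_coord_lift !mxE.
  rewrite in_itv/= => -[H0 H] j; case: (unliftP ord0 j) => [k ->|->].
    by have := H k; rewrite insert_coord_lift !mxE.
  by rewrite insert_coord_eq.
rewrite product_measure1E//; last exact: measurable_box.
rewrite IH; last by move=> j; rewrite !mxE.
have lab : lebesgue_measure ([set` `[a 0 ord0, b 0 ord0]] : set R) =
    (b 0 ord0 - a 0 ord0)%:E.
  rewrite lebesgue_measure_itv/= lte_fin; case: ltP => // ba.
  by rewrite (@le_anti _ _ (a 0 ord0) (b 0 ord0)) ?subrr// ab ba.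
congr (_ * _)%E; first exact: lab.
by congr (_%:E); apply: eq_bigr => j _; rewrite !mxE.
Qed.

End lebesgue_rV.

Section slice_average.
Context {R : realType} (d : nat) (a b : 'rV[R]_d) (i : 'I_d).

(* By Fubini the slices of an integrable [phi] are integrable for a.e. [x]; at
   the exceptional [x] the value is junk, so only a.e. statements about
   [slice_average phi] are meaningful. *)
Definition slice_average (phi : 'rV[R]_d -> R) (x : 'rV[R]_d.-1) : R :=
  (b 0 i - a 0 i)^-1 *
  \int[lebesgue_measure]_(t in `[a 0 i, b 0 i]) phi (insert_coord i x t).

Definition slice_box : set 'rV[R]_d.-1 := box (col' i a) (col' i b).

Definition centered (phi : 'rV[R]_d -> R) :=
  ae_eq (lebesgue_rV d.-1) slice_box (slice_average phi) (cst 0).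

End slice_average.

Section relative_interior.
Context {R : realType} {V : normedModType R}.

Definition affine_set (M : set V) :=
  forall (x y : V) (t : R), M x -> M y -> M ((1 - t) *: x + t *: y).

Definition affine_hull (A : set V) : set V :=
  \bigcap_(M in [set M | affine_set M /\ A `<=` M]) M.

Definition relative_interior (A : set V) : set V :=
  [set x | affine_hull A x /\
    exists2 e : R, 0 < e & ball x e `&` affine_hull A `<=` A].

End relative_interior.

(* Main.v *)
Require Import Defs.
From mathcomp Require Import all_boot all_order all_algebra.
From mathcomp Require Import all_classical all_reals all_analysis.
From mathcomp Require Import measurable_realfun.
From mathcomp Require Import lra.

Set Implicit Arguments.
Unset Strict Implicit.
Unset Printing Implicit Defensive.

Import Order.TTheory GRing.Theory Num.Theory.
Import numFieldNormedType.Exports.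

Local Open Scope classical_set_scope.
Local Open Scope ring_scope.

(** In both directions the profile of [v] is compared with that of a convex
    [vt]. For almost every [x] the slice of [v] through [x] is integrable (Fubini,
    [ae_integrable_slice]), and every slice of [vt] is integrable because a convex
    function is continuous on the interior of its domain ([convex_continuous]).
    Hence averaging is additive on [vt \- v] for almost every [x], and
    [centered a b i (vt \- v)] says exactly that the profiles of [v] and [vt]
    agree almost everywhere ([centered_subE]).

    - From (i) to (ii): averaging the convexity inequality of [vt] over the
      [i]th coordinate shows that the profile of [vt] is convex
      ([slice_average_convex]); it is the required [m].
    - From (ii) to (i): take [vt := m \o col' i], which is convex and constant on
      slices, so that its profile is [m] ([slice_average_col']).
    - Last claim: if [vt] is convex on [N] and [vt \- v] is centered, the profile
      of [vt] is a representative of that of [v]. It is convex on a set containing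
      [slice_box a b i], hence continuous on the interior of that box, which
      contains the relative interior ([relative_interior_solid]).

    Fubini has to be applied in the coordinate [i], whereas [lebesgue_rV] is built
    by adding coordinates at position [0]; [lebesgue_rV_insert] shows that
    inserting at any position gives the same measure. *)

(** * Continuity of convex functions on row vectors *)

Section convex_continuity.
Context {R : realType}.

(** The convexity inequality with an ordinary real weight in place of [{i01 R}],
    so that linear arithmetic applies to it; likewise for sets below. *)
Lemma convex_functionP (E : lmodType R) (D : set E) (f : E -> R) :
  convex_function D f <->
  forall (x y : E) (t : R), 0 <= t <= 1 -> D x -> D y ->
    f (t *: x + (1 - t) *: y) <= t * f x + (1 - t) * f y.
Proof.
split=> [cf x y t /andP[t0 t1] Dx Dy|cf t x y].
  by have := cf (Itv01 t0 t1) x y (mem_set Dx) (mem_set Dy).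
by rewrite !inE => Dx Dy; apply: (cf x y t%:num) => //; rewrite ge0 le1.
Qed.

Lemma convex_setP (E : lmodType R) (D : set E) :
  convex_set D <->
  forall (x y : E) (t : R), 0 <= t <= 1 -> D x -> D y ->
    D (t *: x + (1 - t) *: y).
Proof.
split=> [cD x y t /andP[t0 t1] Dx Dy|cD x y t].
  by have := cD x y (Itv01 t0 t1) (mem_set Dx) (mem_set Dy); rewrite inE.
by rewrite !inE => Dx Dy; apply: (cD x y t%:num) => //; rewrite ge0 le1.
Qed.

Lemma conv_translate (E : lmodType R) (t : R) (p x y : E) :
  t *: (p + x) + (1 - t) *: (p + y) = p + (t *: x + (1 - t) *: y).
Proof. by rewrite !scalerDr addrACA -scalerDl [t + _]addrC subrK scale1r. Qed.

Lemma interior_normP (E : normedModType R) (D : set E) (p : E) :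
  D° p <-> exists2 r : R, 0 < r & forall z, `|z| < r -> D (p + z).
Proof.
split=> [/nbhs_ballP[r /= r0 Hr]|[r r0 Hr]].
  by exists r => // z zr; apply: Hr; rewrite -ball_normE /= opprD addNKr normrN.
apply/nbhs_ballP; exists r => // z; rewrite -ball_normE /= distrC => pz.
by rewrite -[z](subrK p) addrC; exact: Hr.
Qed.

Lemma interior_conv (E : normedModType R) (N : set E) (x y : E) (t : R) :
  convex_set N -> 0 <= t <= 1 -> N° x -> N° y -> N° (t *: x + (1 - t) *: y).
Proof.
move=> /convex_setP cN t01 /interior_normP[r r0 Hr] /interior_normP[s s0 Hs].
apply/interior_normP; exists (Num.min r s); first by rewrite lt_min r0.
move=> z; rewrite lt_min => /andP[zr zs].
rewrite addrC -conv_translate ![z + _]addrC.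
by apply: cN => //; [exact: Hr|exact: Hs].
Qed.

(** For small [s] the point [p + s *: w] lies between [p] and one of the two fixed
    points [p + e *: w], [p - e *: w], so the convexity inequality bounds the
    growth of [f] linearly in [s]. *)
Lemma convex_line_growth (E : normedModType R) (D : set E) (f : E -> R)
    (p w : E) :
  convex_function D f -> D° p ->
  exists K e : R, [/\ 0 <= K, 0 < e &
    forall s, `|s| <= e -> f (p + s *: w) - f p <= K * `|s|].
Proof.
move=> /convex_functionP cf /interior_normP[r r0 Hr].
have w0 : 0 < `|w| + 1 by rewrite ltr_wpDl.
pose e := r / (`|w| + 1).
have e0 : 0 < e by rewrite divr_gt0.
have He s : `|s| <= e -> D (p + s *: w).
  move=> se; apply: Hr; rewrite normrZ.
  apply: (le_lt_trans (ler_wpM2r (normr_ge0 w) se)).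
  by rewrite /e mulrAC ltr_pdivrMr// ltr_pM2l// ltrDl.
pose C := `|f (p + e *: w) - f p| + `|f (p + (- e) *: w) - f p|.
exists (C / e), e; split => //.
  by rewrite divr_ge0 ?addr_ge0 ?normr_ge0// ltW.
move=> s s_le.
have Dp0 : D p by have := He 0; rewrite scale0r addr0 normr0; apply; exact: ltW.
have H c : `|c| = e -> f (p + c *: w) - f p <= C ->
  f (p + (`|s| / e * c) *: w) - f p <= C / e * `|s|.
  move=> ce cC.
  have t01 : 0 <= `|s| / e <= 1.
    apply/andP; split; first by rewrite divr_ge0// ltW.
    by rewrite ler_pdivrMr// mul1r.
  have := cf (p + c *: w) p _ t01 (He c _) Dp0; rewrite ce lexx => /(_ isT).
  have -> : (`|s| / e) *: (p + c *: w) + (1 - `|s| / e) *: p =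
     p + (`|s| / e * c) *: w.
    by rewrite scalerDr scalerA scalerBl scale1r addrC addrA subrK.
  rewrite mulrAC -mulrA => h.
  have : `|s| / e * (f (p + c *: w) - f p) <= `|s| / e * C.
    by apply: ler_wpM2l => //; case/andP: t01.
  lra.
have [s0|s0] := leP 0 s.
- have := H e; rewrite gtr0_norm// ger0_norm// divfK ?gt_eqF//; apply => //.
  by rewrite /C; apply: le_trans (ler_norm _) _; rewrite lerDl.
- have := H (- e); rewrite normrN gtr0_norm// ltr0_norm// mulrN -mulNr mulNr.
  rewrite divfK ?gt_eqF// opprK; apply => //.
  by rewrite /C; apply: le_trans (ler_norm _) _; rewrite lerDr.
Qed.

Lemma coord_le_mx_norm n (u : 'rV[R]_n) j : `|u 0 j| <= `|u|.
Proof.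
rewrite [leRHS]/Num.norm/= mx_normrE.
exact: (le_bigmax _ (fun ij : 'I_1 * 'I_n => `|u ij.1 ij.2|) (0, j)).
Qed.

Lemma mx_norm_le n (u : 'rV[R]_n) (c : R) : 0 <= c ->
  (forall j, `|u 0 j| <= c) -> `|u| <= c.
Proof.
move=> c0 uc; rewrite [leLHS]/Num.norm/= mx_normrE.
by apply: bigmax_le => // -[i j] _ /=; rewrite ord1.
Qed.

(** Induction on the number [k] of coordinates in which [u] may be nonzero: if
    [u = u1 + u_k e_k], then [p + u] is the midpoint of [p + 2 u1] and
    [p + 2 u_k e_k], so the bounds for [u1] and along the line of [e_k] add up. *)
Lemma convex_growth n (D : set 'rV[R]_n) (f : 'rV[R]_n -> R) (p : 'rV[R]_n) :
  convex_function D f -> D° p ->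
  exists K e : R, [/\ 0 <= K, 0 < e &
    forall u : 'rV[R]_n, `|u| < e -> f (p + u) - f p <= K * `|u|].
Proof.
move=> cf Dp.
suff H k : exists K e : R, [/\ 0 <= K, 0 < e &
    forall u : 'rV[R]_n, (forall j : 'I_n, (k <= j)%N -> u 0 j = 0) ->
      `|u| < e -> f (p + u) - f p <= K * `|u|].
  have [K [e [K0 e0 Ke]]] := H n; exists K, e; split => // u.
  by apply: Ke => j; rewrite leqNgt ltn_ord.
elim: k => [|k [K [e [K0 e0 IH]]]].
  exists 0, 1; split => // u u0 _.
  have -> : u = 0 by apply/rowP => j; rewrite u0// mxE.
  by rewrite addr0 subrr mul0r.
have [kn|nk] := ltnP k n; last first.
  exists K, e; split => // u u0; apply: IH => j kj.
  by move: (ltn_ord j); rewrite ltnNge (leq_trans nk kj).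
pose k' := Ordinal kn; pose w : 'rV[R]_n := delta_mx 0 k'.
have [L [c [L0 c0 HL]]] := convex_line_growth w cf Dp.
have /interior_normP[r r0 Hr] := Dp.
(* Half the radius: the end points of which [p + u] is the midpoint are up to
   twice as far from [p]. *)
exists (L + K), (Num.min (Num.min e c) r / 2); split; first exact: addr_ge0.
  by rewrite divr_gt0// !lt_min e0 c0 r0.
move=> u u0; rewrite ltr_pdivlMr// !lt_min => /andP[/andP[ue uc] ur].
pose u1 : 'rV[R]_n := u - u 0 k' *: w.
have u1E j : u1 0 j = if j == k' then 0 else u 0 j.
  rewrite !mxE eqxx /=; case: eqVneq => [->|_]; first by rewrite mulr1 subrr.
  by rewrite mulr0 subr0.
have u1u : `|u1| <= `|u|.
  apply: mx_norm_le => // j; rewrite u1E; case: ifP => _.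
    by rewrite normr0.
  exact: coord_le_mx_norm.
have norm2 (z : 'rV[R]_n) : `|2 *: z| = `|z| * 2.
  by rewrite normrZ (_ : `|2| = 2 :> R) ?normr_nat// mulrC.
have ukE : u = 2^-1 *: (2 *: u1) + (1 - 2^-1) *: ((2 * u 0 k') *: w).
  rewrite !scalerA mulVf ?pnatr_eq0// scale1r mulrA.
  by rewrite (_ : (1 - 2^-1) * 2 = 1 :> R) ?mul1r ?subrK//; lra.
have w1 : `|w| <= 1.
  apply: mx_norm_le => // j; rewrite mxE /=.
  by case: eqP => _; rewrite ?normr1 ?normr0.
have uk := coord_le_mx_norm u k'.
have uk2 : `|2 * u 0 k'| = 2 * `|u 0 k'| by rewrite normrM normr_nat.
have A1 : f (p + 2 *: u1) - f p <= K * `|2 *: u1|.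
  apply: IH => [j kj|]; last by rewrite norm2; nra.
  rewrite mxE u1E; case: eqVneq => [_|jk]; first by rewrite mulr0.
  rewrite u0 ?mulr0// ltn_neqAle kj andbT; apply: contra jk => /eqP jk.
  by apply/eqP/val_inj; rewrite /= jk.
have A2 : f (p + (2 * u 0 k') *: w) - f p <= L * `|2 * u 0 k'|.
  by apply: HL; rewrite uk2; lra.
have h01 : 0 <= (2^-1 : R) <= 1 by rewrite invr_ge0 ler0n /= invf_le1 ?ler1n.
have D1 : D (p + 2 *: u1) by apply: Hr; rewrite norm2; lra.
have D2 : D (p + (2 * u 0 k') *: w).
  apply: Hr; rewrite normrZ uk2; apply: (@le_lt_trans _ _ (`|u| * 2)) => //.
  by apply: le_trans (ler_piMr _ w1) _; [exact: mulr_ge0|lra].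
have := (convex_functionP _ _).1 cf _ _ _ h01 D1 D2.
rewrite conv_translate -ukE.
rewrite norm2 in A1; rewrite uk2 in A2 => h.
nra.
Qed.

(** The growth bound gives [f (p + u) - f p <= K |u|]. As [p] is the midpoint of
    [p + u] and [p - u], the bound for [- u] turns into the matching lower bound. *)
Lemma convex_continuous n (D : set 'rV[R]_n) (f : 'rV[R]_n -> R)
    (p : 'rV[R]_n) :
  convex_function D f -> D° p -> {for p, continuous f}.
Proof.
move=> cf Dp; have [K [e [K0 e0 H]]] := convex_growth cf Dp.
have /interior_normP[r r0 Hr] := Dp.
apply/(@cvgrPdist_le _ _ _ (nbhs p)) => eps eps0.
have d0 : 0 < Num.min (Num.min e r) (eps / (K + 1)).
  by rewrite !lt_min e0 r0 divr_gt0// ltr_wpDl.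
apply/nbhs_ballP; exists (Num.min (Num.min e r) (eps / (K + 1))) => // x.
rewrite -ball_normE /= distrC !lt_min => /andP[/andP[]].
have xE : x = p + (x - p) by rewrite addrC subrK.
rewrite {4}xE; set u := x - p => ue ur uK.
have A1 := H u ue.
have A2 := H (- u); rewrite normrN in A2; have {}A2 := A2 ue.
have h01 : 0 <= (2^-1 : R) <= 1 by rewrite invr_ge0 ler0n /= invf_le1 ?ler1n.
have D2 : D (p - u) by apply: Hr; rewrite normrN.
have := (convex_functionP _ _).1 cf _ _ _ h01 (Hr u ur) D2.
rewrite conv_translate scalerN -scalerBl.
rewrite (_ : 2^-1 - (1 - 2^-1) = 0 :> R); last by lra.
rewrite scale0r addr0.
move=> h.
rewrite ler_norml.
have Ku : K * `|u| <= eps.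
  move: uK; rewrite ltr_pdivlMr ?ltr_wpDl// => uK.
  have := normr_ge0 u; nra.
apply/andP; split; lra.
Qed.

End convex_continuity.

(** * Lebesgue measure and insertion of a coordinate *)

Section lebesgue_insert.
Context {R : realType}.

Definition rectangle n (A : 'I_n -> set R) : set 'rV[R]_n :=
  [set x | forall j, A j (x 0 j)].

Lemma measurable_rectangle n (A : 'I_n -> set (measurableTypeR R)) :
  (forall j, measurable (A j)) -> measurable (rectangle A).
Proof.
move=> mA.
have -> : rectangle A =
    \bigcap_(j in [set: 'I_n]) (rV_coord j @^-1` A j).
  by apply/seteqP; split=> x H j; [move=> _|]; exact: H.
apply: fin_bigcap_measurable; first exact: finite_finset.
move=> j _; rewrite -[X in measurable X]setTI.
exact: measurable_rV_coord.
Qed.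

Lemma preimage_insert_rectangle n (i : 'I_n.+1) (A : 'I_n.+1 -> set R) :
  (fun p : R * 'rV[R]_n => insert_coord i p.2 p.1) @^-1` rectangle A =
  A i `*` rectangle (A \o lift i).
Proof.
apply/seteqP; split => -[t x] /= H.
  split; first by have := H i; rewrite insert_coord_eq.
  by move=> j /=; have := H (lift i j); rewrite insert_coord_lift.
by move=> j; case: (unliftP i j) => [k ->|->];
  rewrite ?insert_coord_lift ?insert_coord_eq; apply H.
Qed.

Lemma lebesgue_rV_rectangle n (A : 'I_n -> set (measurableTypeR R)) :
  (forall j, measurable (A j)) ->
  (lebesgue_rV n (rectangle A) = \prod_j lebesgue_measure (A j))%E.
Proof.
elim: n A => [|n IH] A mA.
  rewrite big_ord0 /= diracE mem_set//= => j; by case: j.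
rewrite big_ord_recl -IH; last by move=> j; exact: mA.
rewrite -(product_measure1E _ (lebesgue_rV n))//; last first.
  exact: measurable_rectangle.
by rewrite /= /lebesgue_rV_succ /pushforward -preimage_insert_rectangle.
Qed.

Lemma measurable_insert_coord n (i : 'I_n.+1) :
  measurable_fun setT (fun p : measurableTypeR R * 'rV[R]_n =>
    insert_coord i p.2 p.1).
Proof.
apply: measurable_fun_rV => j.
case: (unliftP i j) => [k ->|->].
- rewrite (_ : _ \o _ = rV_coord k \o snd).
    exact: measurableT_comp (measurable_rV_coord k) measurable_snd.
  by apply/funext => p /=; rewrite /rV_coord insert_coord_lift.
- rewrite (_ : _ \o _ = fst); first exact: measurable_fst.
  by apply/funext => p /=; rewrite /rV_coord insert_coord_eq.
Qed.

(** Rectangles with measurable sides form a generating pi-system on which both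
    measures are the product of the measures of the sides, the factor [i] being
    singled out on the right. *)
Lemma lebesgue_rV_insert n (i : 'I_n.+1) (B : set 'rV[R]_n.+1) :
  measurable B ->
  lebesgue_rV n.+1 B =
  pushforward (@lebesgue_measure R \x lebesgue_rV n)%E
    (fun p : measurableTypeR R * 'rV[R]_n => insert_coord i p.2 p.1) B.
Proof.
pose G : set (set 'rV[R]_n.+1) := [set rectangle A | A in
  [set A : 'I_n.+1 -> set (measurableTypeR R) | forall j, measurable (A j)]].
pose C (k : nat) : set 'rV[R]_n.+1 := box (const_mx (- k%:R)) (const_mx k%:R).
have boxE (a b : 'rV[R]_n.+1) :
    box a b = rectangle (fun j => [set` `[a 0 j, b 0 j]]).
  by apply/seteqP; split => x H j; have := H j; rewrite /= in_itv.
move=> mB.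
(* The cubes [C k] form a covering sequence of finite measure. *)
apply: (measure_unique G C _ _ _ _ (lebesgue_rV n.+1)
  (measure_function_pushforward__canonical__measure_function_Measure _
    (measurable_insert_coord i))) => //.
- apply/seteqP; split.
    apply: smallest_sub; first exact: smallest_sigma_algebra.
    rewrite -bigcup_seq; apply: bigcup_sub => j _ _ [D mD <-].
    apply: sub_sigma_algebra; exists (fun k => if k == j then D else setT).
      by move=> k /=; case: ifP.
    rewrite setTI; apply/seteqP; split => x /=.
      by move/(_ j); rewrite eqxx.
    by move=> Dx k; case: eqP => // ->.
  apply: smallest_sub; first exact: sigma_algebra_measurable.
  by move=> _ [A mA <-]; exact: measurable_rectangle.
- move=> _ _ [A mA <-] [A' mA' <-]; exists (fun j => A j `&` A' j).
    by move=> j; exact: measurableI.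
  apply/seteqP; split => [x H|x [H H'] j]; last by split; [exact: H|exact: H'].
  by split=> j; have [] := H j.
- move=> k; rewrite /C boxE; eexists; last reflexivity.
  by move=> j; exact: measurable_itv.
- apply/seteqP; split => // x _.
  exists (Num.truncn `|x|).+1 => // j; rewrite !mxE -ler_norml.
  by apply: le_trans (coord_le_mx_norm x j) _; apply/ltW; exact: truncnS_gt.
- move=> _ [A mA <-]; transitivity (lebesgue_rV n.+1 (rectangle A)) => //.
  rewrite lebesgue_rV_rectangle//= /pushforward.
  rewrite preimage_insert_rectangle product_measure1E//; last first.
    by apply: measurable_rectangle => j; exact: mA.
  rewrite lebesgue_rV_rectangle; last by move=> j; exact: mA.
  by rewrite (bigD1_ord i).
- move=> k; suff : (lebesgue_rV n.+1 (C k) < +oo)%E by [].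
  rewrite lebesgue_rV_box ?ltry// => j; rewrite !mxE.
  by rewrite -subr_ge0 opprK addr_ge0.
Qed.
End lebesgue_insert.

(** * Slices of an integrable function *)

Section ae_slices.
Context {R : realType}.

(** Slices are segments of the affine line directed by the [i]th basis vector;
    this gives the continuity of [insert_coord i x]. *)
Lemma insert_coord_line d (i : 'I_d) (x : 'rV[R]_d.-1) (t : R) :
  insert_coord i x t = insert_coord i x 0 + t *: delta_mx 0 i.
Proof.
apply/rowP => j; case: (unliftP i j) => [k ->|->].
  rewrite [RHS]mxE !insert_coord_lift !mxE eqxx eq_sym.
  by rewrite (negbTE (neq_lift _ _)) mulr0 addr0.
by rewrite [RHS]mxE !insert_coord_eq !mxE !eqxx mulr1 add0r.
Qed.

Lemma insert_coord_conv d (i : 'I_d) (x y : 'rV[R]_d.-1) (r t : R) :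
  insert_coord i (t *: x + (1 - t) *: y) r =
  t *: insert_coord i x r + (1 - t) *: insert_coord i y r.
Proof.
apply/rowP => j; case: (unliftP i j) => [k ->|->].
  by rewrite !mxE liftK !mxE.
by rewrite !mxE unlift_none -mulrDl addrC subrK mul1r.
Qed.

Lemma insert_coordK d (i : 'I_d) (x : 'rV[R]_d.-1) (t : R) :
  col' i (insert_coord i x t) = x.
Proof. by apply/rowP => k; rewrite mxE insert_coord_lift. Qed.

Lemma insert_coord_box d (a b : 'rV[R]_d) (i : 'I_d) (x : 'rV[R]_d.-1)
    (t : R) :
  box a b (insert_coord i x t) <->
  slice_box a b i x /\ t \in `[a 0 i, b 0 i].
Proof.
split=> [H|[H tab] j].
  split; last by have := H i; rewrite insert_coord_eq in_itv.
  by move=> k; have := H (lift i k); rewrite insert_coord_lift !mxE.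
case: (unliftP i j) => [k ->|->]; last first.
  by rewrite insert_coord_eq; move: tab; rewrite in_itv.
by have := H k; rewrite insert_coord_lift !mxE.
Qed.

(** Extending [v] by zero outside the box and transporting it along
    [lebesgue_rV_insert] makes it integrable for a product measure, to which
    Fubini applies. *)
Lemma ae_integrable_slice d (a b : 'rV[R]_d) (i : 'I_d) (v : 'rV[R]_d -> R) :
  (lebesgue_rV d).-integrable (box a b) (EFin \o v) ->
  \forall x \ae lebesgue_rV d.-1, slice_box a b i x ->
    (@lebesgue_measure R).-integrable `[a 0 i, b 0 i]
      (fun t => (v (insert_coord i x t))%:E).
Proof.
case: d a b i v => [a b [] //|n a b i v].
move/(integrable_mkcond _ (measurable_box a b)).
set F := (_ \_ _) => /integrableP[mF Foo].
have intF : (@lebesgue_measure R \x lebesgue_rV n)%E.-integrable setT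
    (fun p => F (insert_coord i p.2 p.1)).
  apply/integrableP; split.
    exact: measurableT_comp mF (measurable_insert_coord i).
  apply: le_lt_trans Foo; rewrite le_eqVlt; apply/orP; left; apply/eqP.
  rewrite [RHS](eq_measure_integral (pushforward
    (@lebesgue_measure R \x lebesgue_rV n)%E
    (fun p : measurableTypeR R * 'rV[R]_n => insert_coord i p.2 p.1))); last first.
    by move=> ? A mA _; exact: lebesgue_rV_insert.
  move=> mI; rewrite ge0_integral_pushforward ?preimage_setT//.
    exact: measurableT_comp.
  exact: measurable_insert_coord.
apply: filterS (ae_integrable2 intF) => x /= intFx xab.
apply/integrable_mkcond; first exact: measurable_itv.
apply: (eq_integrable _ _ _ _ intFx) => // t _.
rewrite /F /patch; congr (if _ then _ else _).
apply/idP/idP; rewrite !inE => H.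
  by have [] := (insert_coord_box _ _ _ _ _).1 H.
by apply/insert_coord_box.
Qed.

End ae_slices.

(** * Slice averages of convex functions *)

Section slice_average_theory.
Context {R : realType} (d : nat) (a b : 'rV[R]_d) (i : 'I_d).
Context (ab : a 0 i < b 0 i).

Lemma slice_average_col' (m : 'rV[R]_d.-1 -> R) x :
  slice_average a b i (m \o col' i) x = m x.
Proof.
rewrite /slice_average /=.
under eq_Rintegral do rewrite insert_coordK.
rewrite Rintegral_cst//= lebesgue_measure_itv/= lte_fin ab /=.
by rewrite mulrCA mulVf ?mulr1// subr_eq0 gt_eqF.
Qed.

(** The average of the difference splits on every slice where [v] is integrable,
    hence on almost every slice by [ae_integrable_slice]. *)
Lemma centered_subE (v w : 'rV[R]_d -> R) :
  (lebesgue_rV d).-integrable (box a b) (EFin \o v) ->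
  (forall x, slice_box a b i x -> (@lebesgue_measure R).-integrable
     `[a 0 i, b 0 i] (fun t => (w (insert_coord i x t))%:E)) ->
  centered a b i (w \- v) <->
  slice_average a b i v = slice_average a b i w
    %[ae lebesgue_rV d.-1 in slice_box a b i].
Proof.
move=> /(ae_integrable_slice i) iv iw.
have E : \forall x \ae lebesgue_rV d.-1, slice_box a b i x ->
   slice_average a b i (w \- v) x =
   slice_average a b i w x - slice_average a b i v x.
  apply: filterS iv => x ivx xab.
  by rewrite /slice_average /= RintegralB ?mulrBr//; [exact: iw|exact: ivx].
split=> H.
  apply: filterS2 E H => x Ex Hx xab; have := Hx xab; rewrite Ex//.
  by move/eqP; rewrite subr_eq0 => /eqP.
by apply: filterS2 E H => x Ex Hx xab; rewrite Ex// Hx// subrr.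
Qed.

Lemma integrable_slice_convex (N : set 'rV[R]_d) (f : 'rV[R]_d -> R) x :
  convex_function N f ->
  (forall t, t \in `[a 0 i, b 0 i] -> N° (insert_coord i x t)) ->
  (@lebesgue_measure R).-integrable `[a 0 i, b 0 i]
    (fun t => (f (insert_coord i x t))%:E).
Proof.
move=> cf Nx.
apply: (@continuous_compact_integrable _ (fun t => f (insert_coord i x t))).
  exact: segment_compact.
apply: continuous_in_subspaceT => t; rewrite inE => /= tab.
apply: (@continuous_comp _ _ _ (insert_coord i x) f); last first.
  exact: convex_continuous cf (Nx t tab).
rewrite (_ : insert_coord i x = fun t => insert_coord i x 0 + t *: delta_mx 0 i).
  by apply: cvgD; [exact: cvg_cst|apply: cvgZr_tmp; exact: cvg_id].
by apply/funext => s; exact: insert_coord_line.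
Qed.

(** With the interior of [N] in place of [N], a convex function on [N] is
    continuous on the whole closed slice, end points included. *)
Definition slices_inside (N : set 'rV[R]_d) : set 'rV[R]_d.-1 :=
  [set x | forall t, t \in `[a 0 i, b 0 i] -> N° (insert_coord i x t)].

(** Both sides of the convexity inequality are integrated over the slice; the
    slice through the intermediate point stays in the interior of [N] because the
    interior of a convex set is convex. *)
Lemma slice_average_convex (N : set 'rV[R]_d) (f : 'rV[R]_d -> R) :
  convex_set N -> convex_function N f ->
  convex_function (slices_inside N) (slice_average a b i f).
Proof.
move=> cN cf; apply/convex_functionP => x y t t01 Nx Ny.
have Nxy : slices_inside N (t *: x + (1 - t) *: y).
  move=> s sab; rewrite insert_coord_conv.
  by apply: interior_conv; [| |exact: Nx|exact: Ny].
have ix := integrable_slice_convex cf Nx.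
have iy := integrable_slice_convex cf Ny.
have ixy := integrable_slice_convex cf Nxy.
rewrite /slice_average !(mulrCA _ (_^-1)) -mulrDr ler_wpM2l//.
  by rewrite invr_ge0 subr_ge0 ltW.
have mI : measurable ([set` `[a 0 i, b 0 i]] : set (measurableTypeR R)).
  exact: measurable_itv.
have ixt := integrableZl mI t ix.
have iyt := integrableZl mI (1 - t) iy.
rewrite -!RintegralZl// -RintegralD//.
apply: le_Rintegral => //; first exact: (integrableD _ ixt iyt).
move=> s sab; rewrite insert_coord_conv.
apply: (convex_functionP _ _).1 cf _ _ _ t01 _ _.
  by apply: interior_subset; exact: Nx.
by apply: interior_subset; exact: Ny.
Qed.

End slice_average_theory.

(** * Boxes and relative interiors *)

Section boxes.
Context {R : realType}.

Lemma open_open_box n (a b : 'rV[R]_n) : open (open_box a b).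
Proof.
rewrite openE => x xab; rewrite /interior.
apply: (@filter_forall _ _ (fun j (y : 'rV[R]_n) => a 0 j < y 0 j < b 0 j)
  (nbhs x) (nbhs_filter x)) => j; have /andP[ax xb] := xab j.
apply: (@coord_continuous R 1 n 0 j x (fun s => a 0 j < s < b 0 j)).
near=> s; apply/andP; split; near: s; [exact: lt_nbhsr|exact: lt_nbhsl].
Unshelve. all: by end_near. Qed.

Lemma convex_open_box n (a b : 'rV[R]_n) : convex_set (open_box a b).
Proof.
apply/convex_setP => x y t /andP[t0 t1] xab yab j.
have /andP[ax xb] := xab j; have /andP[ay yb] := yab j.
(* One of the two weights is at least [1/2], which keeps the bounds strict. *)
rewrite !mxE; apply/andP; split; have [t2|t2] := leP t 2^-1; nra.
Qed.

Lemma interior_box_nonempty n (a b : 'rV[R]_n) : (forall j, a 0 j < b 0 j) ->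
  (box a b)° !=set0.
Proof.
move=> ab; exists (2^-1 *: (a + b)).
have : open_box a b (2^-1 *: (a + b)).
  by move=> j; rewrite !mxE; apply/andP; have := ab j; split; lra.
move: (@open_open_box n a b); rewrite openE => /[apply].
apply: filterS => x xab j; have /andP[] := xab j.
by move=> /ltW -> /ltW ->.
Qed.

(** A set with an interior point [p] has the whole space as affine hull: every [y]
    lies on the line through [p] and a point close to [p]. So the relative
    neighbourhoods in the definition of the relative interior are neighbourhoods. *)
Lemma relative_interior_solid (V : normedModType R) (A : set V) :
  A° !=set0 -> relative_interior A `<=` A°.
Proof.
move=> [p /interior_normP[r r0 Hr]] x [_ [e e0 He]].
apply/nbhs_ballP; exists e => // y xy; apply: He; split => // M [Maff AM].
pose s := r / (`|y - p| + 1).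
have n0 : 0 < `|y - p| + 1 by rewrite ltr_wpDl.
have s0 : 0 < s by rewrite divr_gt0.
have -> : y = (1 - s^-1) *: p + s^-1 *: (p + s *: (y - p)).
  rewrite scalerDr scalerA mulVf ?gt_eqF// scale1r addrA -scalerDl subrK scale1r.
  by rewrite addrC subrK.
have Ap : A p by rewrite -[p]addr0; apply: Hr; rewrite normr0.
apply: Maff; apply: AM => //; apply: Hr; rewrite normrZ gtr0_norm// /s.
by rewrite mulrAC ltr_pdivrMr// ltr_pM2l// ltrDl.
Qed.

End boxes.

(** * Convexity of the profile characterizes centered convex corrections *)

Theorem proposition3p1 (R : realType) (d : nat) (a b : 'rV[R]_d) (i : 'I_d)
    (v : 'rV[R]_d -> R)
    (ab : forall j, a 0 j < b 0 j)
    (v_L1 : (lebesgue_rV d).-integrable (box a b) (EFin \o v)) :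
  (forall alpha beta : 'rV[R]_d,
    let U := open_box alpha beta in
    box a b `<=` U ->
    (exists vt : 'rV[R]_d -> R,
       convex_function U vt /\ centered a b i (vt \- v))
    <->
    (exists m : 'rV[R]_d.-1 -> R,
       convex_function (col' i @` U) m /\
       slice_average a b i v = m %[ae lebesgue_rV d.-1 in slice_box a b i]))
  /\
  ((~ exists g : 'rV[R]_d.-1 -> R,
       slice_average a b i v = g %[ae lebesgue_rV d.-1 in slice_box a b i] /\
       {within relative_interior (slice_box a b i), continuous g}) ->
   forall N : set 'rV[R]_d,
     box a b `<=` N° -> convex_set N ->
     ~ exists vt : 'rV[R]_d -> R,
         convex_function N vt /\ centered a b i (vt \- v)).
Proof.
have inside (N : set 'rV[R]_d) : box a b `<=` N° ->
    slice_box a b i `<=` slices_inside a b i N.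
  by move=> SN x xS t tab; apply/SN/insert_coord_box.
split=> [alpha beta U SU|no_rep N SN cN [vt [cvt ctr]]].
  have intU : U° = U by apply/interior_id; exact: open_open_box.
  have SU' : box a b `<=` U° by rewrite intU.
  split=> [[vt [cvt ctr]]|[m [cm vm]]].
    exists (slice_average a b i vt); split.
      have /convex_functionP ca :=
        slice_average_convex (ab i) (@convex_open_box _ _ alpha beta) cvt.
      apply/convex_functionP => x y t t01 Ux Uy.
      have sub : col' i @` U `<=` slices_inside a b i U.
        move=> _ [z Uz <-] s sab; rewrite intU => j.
        case: (unliftP i j) => [k ->|->].
          by rewrite insert_coord_lift mxE; exact: Uz.
        (* The side [i] of [U] contains that of the box: test [SU] at a corner. *)
        have aS : box a b (insert_coord i (col' i a) s).
          apply/insert_coord_box; split=> // k.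
          by rewrite !mxE lexx /= ltW.
        by have := SU _ aS i; rewrite !insert_coord_eq.
      by apply: ca => //; exact: sub.
    apply/(centered_subE v_L1 _).1 => // x /(inside _ SU').
    exact: integrable_slice_convex.
  exists (m \o col' i); split.
    move/convex_functionP: cm => cm; apply/convex_functionP => x y t t01 Ux Uy /=.
    rewrite (_ : col' i _ = t *: col' i x + (1 - t) *: col' i y); last first.
      by apply/rowP => k; rewrite !mxE.
    by apply: cm => //; [exists x|exists y].
  apply/(centered_subE v_L1).
    move=> x _; rewrite (_ : (fun t => _) = (fun=> (m x)%:E)); last first.
      by apply/funext => t /=; rewrite insert_coordK.
    apply: (@continuous_compact_integrable _ (fun=> m x)).
      exact: segment_compact.
    by apply: continuous_subspaceT => ?; exact: cvg_cst.
  by apply: filterS vm => x vx xS; rewrite slice_average_col'// vx.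
apply: no_rep; exists (slice_average a b i vt); split.
  apply/(centered_subE v_L1 _).1 => // x /(inside _ SN).
  exact: integrable_slice_convex.
apply: continuous_in_subspaceT => x; rewrite inE => xri.
have cavg := slice_average_convex (ab i) cN cvt.
apply: (convex_continuous cavg); apply: filterS (inside _ SN) _.
apply: relative_interior_solid xri.
by apply: interior_box_nonempty => k; rewrite !mxE.
Qed.
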